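(* Let $m\ge 1$ be an integer and let $t\ge m$ be an integer such that $2\mid\binom{t}{m}$. Then $$\mathsf{EGZ}(t,2,m)=t+2^{\nu_2(m)}=t+\mathsf{D}(\mathbb{Z}_2,m)-m.$$
   Context: $\nu_2(m)$ denotes the $2$-adic valuation of $m$ (the exponent of $2$ in the prime factorization of $m$). A sequence $S$ over $\mathbb{Z}_2$ is a finite sequence of elements of $\mathbb{Z}_2$, order disregarded and repetition allowed (i.e. a finite multiset); its length $|S|$ is the number of its elements counted with multiplicity; a subsequence is a sub-multiset. For a sequence $S=(g_1,\dots,g_\ell)$, $$e_m(S)=\sum_{1\le i_1<\cdots<i_m\le \ell}\ \prod_{j=1}^m g_{i_j}$$ computed in the ring $\mathbb{Z}_2$ (an empty sum is $0$). $\mathsf{D}(\mathbb{Z}_2,m)$ is the smallest positive integer $z$ such that every sequence $S$ over $\mathbb{Z}_2$ of length $|S|\ge z$ contains a subsequence $S'$ of length $|S'|\ge m$ with $e_m(S')=0$. $\mathsf{EGZ}(t,2,m)$ is the smallest positive integer $z$ such that every sequence $S$ over $\mathbb{Z}_2$ of length $|S|\ge z$ contains a subsequence $S'$ of length exactly $t$ with $e_m(S')=0$ (and $\infty$ if no such $z$ exists). *)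

(* Defs.v *)
From HB Require Import structures.
From mathcomp Require Import all_boot all_order all_algebra.
From mathcomp Require Import boolp.

Set Implicit Arguments.
Unset Strict Implicit.
Unset Printing Implicit Defensive.

Import GRing.Theory.

Local Open Scope nat_scope.

(* Lists represent multisets, hence inclusion of multiplicities and not the
   order-sensitive [subseq]. *)
Definition submultiset (T : eqType) (s1 s2 : seq T) : Prop :=
  forall x : T, count_mem x s1 <= count_mem x s2.

(* Index tuples i_1 < ... < i_m are identified with m-element sets of
   positions. *)
Definition esym (R : comNzRingType) (m : nat) (S : seq R) : R :=
  (\sum_(I : {set 'I_(size S)} | #|I| == m) \prod_(i in I) S`_i)%R.

(* [None] stands for infinity. *)
Definition least_pos (P : nat -> Prop) : option nat :=
  match pselect (exists n, (0 < n) && `[< P n >]) with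
  | left exP => Some (ex_minn exP)
  | right _ => None
  end.

Lemma least_pos_SomeP (P : nat -> Prop) (z : nat) :
  least_pos P = Some z <->
  [/\ 0 < z, P z & forall n, 0 < n -> P n -> z <= n].
Proof.
rewrite /least_pos; case: pselect => [exP|nexP]; last first.
  by split=> // -[z0 Pz _]; case: nexP; exists z; rewrite z0; apply/asboolP.
case: ex_minnP => k /andP[k0 /asboolP Pk] kmin; split=> [[<-]|[z0 Pz zmin]].
  by split=> // n n0 Pn; apply: kmin; rewrite n0; apply/asboolP.
congr Some; apply/eqP; rewrite eqn_leq zmin // andbT.
by apply: kmin; rewrite z0; apply/asboolP.
Qed.

Lemma least_pos_NoneP (P : nat -> Prop) :
  least_pos P = None <-> forall n, 0 < n -> ~ P n.
Proof.
rewrite /least_pos; case: pselect => [exP|nexP]; split=> //.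
  by move=> nP; exfalso; case: exP => n /andP[n0 /asboolP Pn]; case: (nP n n0).
by move=> _ n n0 Pn; apply: nexP; exists n; rewrite n0; apply/asboolP.
Qed.

Definition Davenport (R : comNzRingType) (m : nat) : option nat :=
  least_pos (fun z => forall S : seq R, z <= size S ->
    exists S' : seq R,
      [/\ submultiset S' S, m <= size S' & esym m S' = 0%R]).

Definition EGZ (t : nat) (R : comNzRingType) (m : nat) : option nat :=
  least_pos (fun z => forall S : seq R, z <= size S ->
    exists S' : seq R,
      [/\ submultiset S' S, size S' = t & esym m S' = 0%R]).

(* Main.v *)
(** In Z_2, e_m(S) is C(k, m) mod 2, where k is the number of ones in S.  Write
    m = r q with r = 2^(nu_2 m) and q odd; by Lucas, C(k, m) has the parity of
    C(floor(k / r), q), which is even whenever floor(k / r) is.  Hence C(k, m)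
    and C(k + r, m) are never both odd, whereas C(k, m) is odd for all of
    k = m, ..., m + r - 1.  The numbers of ones in the length-t subsequences
    of S form an interval, so a long S reaches an even value, and m + r - 1
    ones together with t - m zeros is an extremal sequence. *)

Require Import Defs.
From HB Require Import structures.
From mathcomp Require Import all_boot all_order all_algebra.
From mathcomp Require Import zify.

Import GRing.Theory.

Local Open Scope nat_scope.

(** Lucas' theorem modulo 2 for the lowest binary digit; both parities of the lower index go through
    one induction on [n], since Pascal's rule mixes them. *)
Lemma odd_bin_half n q :
  (odd 'C(n, q.*2) = odd 'C(n./2, q)) *
  (odd 'C(n, q.*2.+1) = odd n && odd 'C(n./2, q)).
Proof.
elim: n q => [|n IHn] q; first by case: q.
have half_succ : n.+1./2 = odd n + n./2 by rewrite /= uphalf_half.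
split; last first.
  rewrite binS oddD !IHn half_succ /=.
  by case: (odd n); rewrite /= ?addbb.
case: q => [|q]; first by rewrite !bin0.
rewrite doubleS binS oddD -doubleS !IHn half_succ.
by case: (odd n); rewrite ?add0n ?addbF // add1n binS oddD.
Qed.

Lemma odd_bin_pow2 v n q : odd 'C(n, 2 ^ v * q) = odd 'C(n %/ 2 ^ v, q).
Proof.
elim: v n => [|v IHv] n; first by rewrite mul1n divn1.
by rewrite expnS -mulnA mul2n odd_bin_half IHv -divn2 divnMA.
Qed.

Lemma odd_bin_odd n q : odd q -> odd 'C(n, q) -> odd n.
Proof.
by move=> q_odd; rewrite -(odd_double_half q) q_odd odd_bin_half => /andP[].
Qed.

Lemma logn2_odd_part m : 0 < m -> exists2 q, odd q & m = 2 ^ logn 2 m * q.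
Proof.
move=> m_gt0; have [q] := pfactor_coprime (p := 2) isT m_gt0.
by rewrite coprime2n mulnC => q_odd m_eq; exists q.
Qed.

Lemma bin_shift_even m k : 0 < m ->
  odd 'C(k, m) -> ~~ odd 'C(k + 2 ^ logn 2 m, m).
Proof.
move=> m_gt0; have [q q_odd m_eq] := logn2_odd_part m m_gt0.
set v := logn 2 m in m_eq *; rewrite m_eq !odd_bin_pow2 => odd_k.
apply/negP => /(odd_bin_odd _ _ q_odd).
by rewrite divnDr // divnn expn_gt0 addn1 /= (odd_bin_odd _ _ q_odd odd_k).
Qed.

(** On this window the quotient of [k] by [2 ^ logn 2 m] stays equal to the odd part [q] of [m], and
    ['C(q, q) = 1]. *)
Lemma bin_window_odd m k : 0 < m ->
  m <= k -> k < m + 2 ^ logn 2 m -> odd 'C(k, m).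
Proof.
move=> m_gt0 le_mk; rewrite -(subnKC le_mk) ltn_add2l.
have [q _ m_eq] := logn2_odd_part m m_gt0.
move: (k - m) => j; set v := logn 2 m in m_eq *; rewrite m_eq => lt_j.
by rewrite odd_bin_pow2 mulnC divnMDl ?expn_gt0 // divn_small // addn0 binn.
Qed.

Section BinarySequences.

Implicit Types S : seq 'Z_2.

Lemma Z2P (x : 'Z_2) : (x == 0%R) = (x != 1%R).
Proof. by case: x => -[|[|]]. Qed.

Lemma card_nth_count (T : eqType) (x0 x : T) (s : seq T) :
  #|[set i : 'I_(size s) | nth x0 s i == x]| = count_mem x s.
Proof.
rewrite -sum1dep_card -(big_mkord (fun i => nth x0 s i == x) (fun=> 1)).
by rewrite -(big_nth x0 (pred1 x) (fun=> 1)) sum1_count.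
Qed.

(** A product over [I] is 1 if all positions in [I] carry ones and 0 otherwise, so the sum counts
    the [m]-subsets of the set of positions of ones. *)
Lemma esym_Z2 m S : Defs.esym m S = 'C(count_mem 1%R S, m)%:R%R.
Proof.
rewrite -(card_nth_count _ 0%R) -cards_draws -sum1dep_card natr_sum /Defs.esym.
set A := [set i | _].
rewrite [RHS](eq_bigl (fun I : {set 'I__} => (#|I| == m) && (I \subset A)));
  last by move=> I; rewrite andbC.
rewrite [RHS]big_mkcondr; apply: eq_bigr => I _; case: ifPn => [sIA | ].
  by rewrite big1 // => i /(subsetP sIA); rewrite inE => /eqP.
case/subsetPn=> i iI; rewrite inE -Z2P => /eqP Si0.
by rewrite (bigD1 i) //= Si0 mul0r.
Qed.

Lemma esym_Z2_eq0 m S : (Defs.esym m S == 0%R) = ~~ odd 'C(count_mem 1%R S, m).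
Proof.
by rewrite esym_Z2 -(@Zp_nat_mod 2) // modn2; case: (odd _).
Qed.

Lemma count_Z2 S : count_mem 0%R S + count_mem 1%R S = size S.
Proof.
rewrite -(count_predC (pred1 (1%R : 'Z_2)) S) addnC; congr addn.
by apply: eq_count => x; rewrite /= Z2P.
Qed.

(** Normal form of a multiset over Z_2: choosing a subsequence amounts to choosing its two
    multiplicities. *)
Definition binseq a b : seq 'Z_2 := nseq a 1%R ++ nseq b 0%R.

Lemma size_binseq a b : size (binseq a b) = a + b.
Proof. by rewrite size_cat !size_nseq. Qed.

Lemma count1_binseq a b : count_mem 1%R (binseq a b) = a.
Proof. by rewrite count_cat !count_nseq /= mul1n mul0n addn0. Qed.

Lemma count0_binseq a b : count_mem 0%R (binseq a b) = b.
Proof. by rewrite count_cat !count_nseq /= mul1n mul0n. Qed.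

Lemma sub_binseq a b S : a <= count_mem 1%R S -> b <= count_mem 0%R S ->
  submultiset (binseq a b) S.
Proof.
move=> le_a le_b x; have [->|] := eqVneq x 1%R; first by rewrite count1_binseq.
by rewrite -Z2P => /eqP->; rewrite count0_binseq.
Qed.

Lemma esym_binseq_eq0 m a b : ~~ odd 'C(a, m) -> Defs.esym m (binseq a b) = 0%R.
Proof. by move=> even_a; apply/eqP; rewrite esym_Z2_eq0 count1_binseq. Qed.

Lemma EGZ_Z2_upper m t S : 0 < m -> ~~ odd 'C(t, m) ->
    t + 2 ^ logn 2 m <= size S ->
  exists S', [/\ submultiset S' S, size S' = t & Defs.esym m S' = 0%R].
Proof.
move=> m_gt0 even_t; rewrite -count_Z2 => le_S.
set b := count_mem 0%R S in le_S *; set a := count_mem 1%R S in le_S *.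
suff [k [le_ka le_kt le_b even_k]] :
    exists k, [/\ k <= a, k <= t, t - k <= b & ~~ odd 'C(k, m)].
  exists (binseq k (t - k)); split; first exact: sub_binseq.
    by rewrite size_binseq subnKC.
  exact: esym_binseq_eq0.
have [le_ta | lt_at] := leqP t a; first by exists t; rewrite subnn.
have [le_tb | lt_bt] := leqP t b.
  by exists 0; rewrite subn0 bin_small.
(* Now [t - b] is the least possible number of ones. If it fails, raising it by [2 ^ logn 2 m]
   succeeds, and the length of [S] leaves room for this. *)
have [odd_k | even_k] := boolP (odd 'C(t - b, m)); last first.
  by exists (t - b); split=> //; lia.
exists (t - b + 2 ^ logn 2 m); split; [lia | lia | lia |].
exact: bin_shift_even.
Qed.

(** With at most [c] zeros, such an [S] has at least [m] ones, so its number of ones lies in the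
    window of [bin_window_odd]. Both lower bounds follow, with [c = t - m] and [c = 0]. *)
Lemma esym_sub_binseq_neq0 m c S : 0 < m ->
    submultiset S (binseq (m + 2 ^ logn 2 m).-1 c) -> m + c <= size S ->
  Defs.esym m S <> 0%R.
Proof.
move=> m_gt0 subS le_S; apply/eqP; move: le_S.
rewrite esym_Z2_eq0 negbK -count_Z2.
move: (subS 0%R) (subS 1%R); rewrite count0_binseq count1_binseq.
move: (count_mem 0%R S) (count_mem 1%R S) => b a *.
by apply: bin_window_odd => //; lia.
Qed.

Lemma Davenport_Z2_upper m S : 0 < m ->
    m + 2 ^ logn 2 m <= size S ->
  exists S', [/\ submultiset S' S, m <= size S' & Defs.esym m S' = 0%R].
Proof.
move=> m_gt0; rewrite -count_Z2 => le_S.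
have [b0 | b_gt0] := posnP (count_mem 0%R S).
  exists (binseq (m + 2 ^ logn 2 m) 0); split.
  - by apply: sub_binseq; lia.
  - by rewrite size_binseq; lia.
  by apply: esym_binseq_eq0; apply: bin_shift_even; rewrite ?binn.
(* A zero is available, so [m] terms with fewer than [m] ones can be chosen, and then the binomial
   coefficient vanishes. *)
pose k := minn (count_mem 1%R S) m.-1.
exists (binseq k (m - k)); split.
- by apply: sub_binseq; lia.
- by rewrite size_binseq; lia.
by apply: esym_binseq_eq0; rewrite bin_small //; lia.
Qed.

End BinarySequences.

Theorem theorem2p17 (m t : nat) (hm : 1 <= m) (hmt : m <= t)
    (hdvd : 2 %| 'C(t, m)) :
  EGZ t 'Z_2 m = Some (t + 2 ^ logn 2 m) /\
  exists d : nat, Davenport 'Z_2 m = Some d /\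
                  t + 2 ^ logn 2 m = t + d - m.
Proof.
rewrite dvdn2 in hdvd; split.
  apply/least_pos_SomeP; split=> [|S|z _ zP]; first lia.
    exact: EGZ_Z2_upper.
  rewrite leqNgt; apply/negP => lt_z.
  case: (zP (binseq (m + 2 ^ logn 2 m).-1 (t - m))) => [|S' [subS' sizeS']].
    by rewrite size_binseq; lia.
  by apply: esym_sub_binseq_neq0 subS' _; rewrite // sizeS' subnKC.
exists (m + 2 ^ logn 2 m); split; last lia.
apply/least_pos_SomeP; split=> [|S|z _ zP]; first lia.
  exact: Davenport_Z2_upper.
rewrite leqNgt; apply/negP => lt_z.
case: (zP (binseq (m + 2 ^ logn 2 m).-1 0)) => [|S' [subS' sizeS']].
  by rewrite size_binseq; lia.
by apply: esym_sub_binseq_neq0 subS' _; rewrite // addn0.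
Qed.
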